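(* Let $K$ be a field and $S=K[x_1,\ldots,x_n]$. Let $I\supsetneq J$ be square free monomial ideals of $S$ such that $J$ is generated by square free monomials of degrees $\geq 2$ and $I$ is generated by $x_1$ and a nonempty set $E$ of square free monomials of degree $2$ in the variables $x_2,\ldots,x_n$. Let $B$ (resp. $C$) be the set of all square free monomials of degree $2$ (resp. $3$) in $I\setminus J$. Suppose that $\operatorname{sdepth}_S I/J=2$. Let $E'=\{a\in E: x_1a\in C\}$ and $E''=E\setminus E'$. Assume that one of the following conditions holds: (1) $|E''|\leq |C\setminus (x_1,E')|$; (2) $|E''|> |C\setminus (x_1,E')|$ and $|B|\neq |C|+1$. Then $\operatorname{depth}_S I/J\leq 2$.
   Context: A square free monomial ideal is an ideal generated by square free monomials (the zero ideal is allowed). $(x_1,E')$ denotes the ideal of $S$ generated by $x_1$ and the elements of $E'$, so $C\setminus (x_1,E')$ is the set of monomials of $C$ not lying in this ideal. $\operatorname{depth}_S$ is the depth with respect to the graded maximal ideal $(x_1,\ldots,x_n)$. Stanley depth: for square free monomial ideals $I\supsetneq J$, let $P_{I\setminus J}$ be the finite poset of all square free monomials of $I\setminus J$, ordered by divisibility. For $u\mid v$ in $P_{I\setminus J}$, the interval is $[u,v]=\{w\in P_{I\setminus J}: u\mid w,\ w\mid v\}$. For a partition $\mathcal P$ of $P_{I\setminus J}$ into disjoint intervals, $P_{I\setminus J}=\bigcup_i [u_i,v_i]$, put $\operatorname{sdepth}\mathcal P=\min_i \deg v_i$. Then $\operatorname{sdepth}_S I/J=\max_{\mathcal P}\operatorname{sdepth}\mathcal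 P$, where $\mathcal P$ runs over all such partitions. *)

(* Defs.v *)
From mathcomp Require Import all_boot all_order all_algebra.
From mathcomp Require Import mpoly.
From mathcomp Require Import boolp.

Set Implicit Arguments.
Unset Strict Implicit.
Unset Printing Implicit Defensive.

Import GRing.Theory.
Local Open Scope ring_scope.

(* Square free monomials of K[x_0, ..., x_(n-1)] are encoded by their supports
   A : {set 'I_n}: divisibility is inclusion and the degree is #|A|. The
   corresponding polynomial is 'X_[mesym1 A] = \prod_(i in A) 'X_i. *)

(* The ideal generated by the square free monomials in G (zero if G = set0). *)
Definition sqf_ideal (K : fieldType) (n : nat) (G : {set {set 'I_n}})
    (f : {mpoly K[n]}) : Prop :=
  exists c : {set 'I_n} -> {mpoly K[n]},
    f = \sum_(A in G) c A * 'X_[mesym1 A].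

Definition graded_max_ideal (K : fieldType) (n : nat) :
    {mpoly K[n]} -> Prop :=
  sqf_ideal (K := K) [set [set i] | i : 'I_n].

(* For ideals N of R contained in the ideal M: the ideal N + (s_0, ..., s_(r-1)) M, so that M / seq_submod M N s is
   (M / N) / (s_0, ..., s_(r-1)) (M / N). *)
Definition seq_submod (R : comNzRingType) (M N : R -> Prop) (s : seq R)
    (g : R) : Prop :=
  exists h : R, exists u : 'I_(size s) -> R,
    [/\ N h, forall j, M (u j) & g = h + \sum_(j < size s) s`_j * u j].

(* s is an M / N-regular sequence of elements of m. *)
Definition regular_seq (R : comNzRingType) (m M N : R -> Prop)
    (s : seq R) : Prop :=
  [/\ forall f, f \in s -> m f,
      forall i, (i < size s)%N -> forall g, M g ->
        seq_submod M N (take i s) (s`_i * g) -> seq_submod M N (take i s) g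
    & exists g, M g /\ ~ seq_submod M N s g].

(* The depth of M / N with respect to m is d. *)
Definition is_depth (R : comNzRingType) (m M N : R -> Prop) (d : nat) : Prop :=
  (exists2 s, regular_seq m M N s & size s = d) /\
  (forall s, regular_seq m M N s -> (size s <= d)%N).

Definition sqf_monomials (K : fieldType) (n : nat) (I J : {mpoly K[n]} -> Prop) :
    {set {set 'I_n}} :=
  [set A | `[< I 'X_[mesym1 A] /\ ~ J 'X_[mesym1 A] >]].

Definition interval (n : nat) (P : {set {set 'I_n}})
    (p : {set 'I_n} * {set 'I_n}) : {set {set 'I_n}} :=
  [set w in P | (p.1 \subset w) && (w \subset p.2)].

(* Q is the set of pairs of end points (u_i, v_i) of the intervals. *)
Definition interval_partition (n : nat) (P : {set {set 'I_n}})
    (Q : {set {set 'I_n} * {set 'I_n}}) : bool :=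
  [&& [forall p in Q, [&& p.1 \in P, p.2 \in P & p.1 \subset p.2]],
      [forall p in Q, forall q in Q,
         (p != q) ==> [disjoint interval P p & interval P q]]
    & P == \bigcup_(p in Q) interval P p].

(* The unit n of the minimum is harmless: all degrees are at most n. *)
Definition partition_sdepth (n : nat) (Q : {set {set 'I_n} * {set 'I_n}}) : nat :=
  \big[minn/n]_(p in Q) #|p.2|.

Definition sdepth (K : fieldType) (n : nat) (I J : {mpoly K[n]} -> Prop) : nat :=
  \max_(Q : {set {set 'I_n} * {set 'I_n}} |
        interval_partition (sqf_monomials I J) Q) partition_sdepth Q.

(* Main.v *)
Require Import Defs.
From mathcomp Require Import all_boot all_order all_algebra.
From mathcomp Require Import fingroup perm.
From mathcomp Require Import mpoly.
From mathcomp Require Import boolp.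
From mathcomp Require Import ring.

(** Write M for I/J. The claim is that an M-regular sequence of length 3 in the
    maximal ideal forces sdepth M >= 3; hence sdepth M = 2 bounds the length of
    every regular sequence by 2.

    Algebra. A regular sequence of length 3 makes the Koszul cohomology
    H^2(x_1, ..., x_n; M) vanish, since it is killed by the maximal ideal
    ([regular_seq_koszul_exact2]). Giving the basis element e_A the multidegree
    of 1/x^A, the multidegree 0 strand of the Koszul complex is
    K x_1 -> K^B -> K^C, the simplicial coboundary on the square free monomials
    of degrees 1, 2, 3, and so the kernel of K^B -> K^C is the line spanned by
    the coboundary of x_1, that is by the signed sum of the x_1 x_i in B. After
    one monomial x_1 x_i0 of B is dropped, the remaining columns of K^B -> K^C
    are linearly independent ([cob_inj]). The strand of multidegree 1/x_i provides
    enough monomials x_1 x_j to work with ([edge_avoiding]).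

    Matching. A nonzero maximal minor of that matrix has a nonzero term in its
    expansion, and this term matches every remaining b in B with its own
    multiple in C. To make x_1 into the bottom of an interval [x_1, v], the
    monomial v = x_1 x_i0 x_j has to be the match of x_1 x_j for some j: then
    [x_1, v] also covers x_1 x_i0 and x_1 x_j. So erase from the matrix the
    entries of the columns x_1 x_j in the rows divisible by x_i0. The columns
    x_1 x_j, j <> i0, now sum to zero up to signs, so the minor becomes 0, and
    some nonzero term of the original minor must use an erased entry
    ([marked_transversal], [star_matching]).

    Partition. The intervals [x_1, v] and [b, f b], together with one-point
    intervals, partition the square free monomials of I \ J, with all top ends
    of degree at least 3 ([sdepth_ge3_matching]). *)

Set Implicit Arguments.
Unset Strict Implicit.
Unset Printing Implicit Defensive.

Import GRing.Theory.

(** * Koszul cohomology in degrees 0, 1 and 2 *)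

Section KoszulVanishing.
Local Open Scope ring_scope.

Variables (R : comNzRingType) (T : finType) (x : T -> R) (M : R -> Prop).

Definition ideal_pred (N : R -> Prop) : Prop :=
  [/\ N 0, forall a b, N a -> N b -> N (a + b)
    & forall c a, N a -> N (c * a)].

Lemma ideal_predB (N : R -> Prop) a b :
  ideal_pred N -> N a -> N b -> N (a - b).
Proof. by case=> _ ND NM Na Nb; apply: ND => //; rewrite -mulN1r; apply: NM. Qed.

Lemma ideal_pred_sum (N : R -> Prop) (I : finType) (F : I -> R) :
  ideal_pred N -> (forall i, N (F i)) -> N (\sum_i F i).
Proof. by case=> N0 ND _ NF; apply: (big_ind N). Qed.

(** Vanishing of H^0, H^1, H^2 of the Koszul complex of M / N with respect to
    the family x. Cochains of degree k are functions of k indices with values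
    in M, alternating or not, and equations hold modulo N. *)
Definition koszul_exact0 (N : R -> Prop) : Prop :=
  forall z, M z -> (forall i, N (x i * z)) -> N z.

Definition koszul_exact1 (N : R -> Prop) : Prop :=
  forall y : T -> R, (forall i, M (y i)) ->
    (forall i j, N (x i * y j - x j * y i)) ->
  exists2 w, M w & forall i, N (y i - x i * w).

Definition koszul_exact2 (N : R -> Prop) : Prop :=
  forall z : T -> T -> R, (forall i j, M (z i j)) ->
    (forall i j k, N (x i * z j k - x j * z i k + x k * z i j)) ->
  exists2 w : T -> R, (forall i, M (w i)) &
    forall i j, N (z i j - (x i * w j - x j * w i)).

Variables (N N' : R -> Prop) (f : R) (a : T -> R).
Hypothesis idealM : ideal_pred M.
Hypothesis idealN : ideal_pred N.
Hypothesis f_in_x : f = \sum_i a i * x i.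
Hypothesis f_regular : forall g, M g -> N (f * g) -> N g.
Hypothesis N'E : forall g, N' g <-> exists h u, [/\ N h, M u & g = h + f * u].

Lemma koszul_exact0_regular : koszul_exact0 N.
Proof.
move=> z Mz Nz; apply: f_regular => //; rewrite f_in_x mulr_suml.
by apply: ideal_pred_sum => // i; rewrite -mulrA; case: idealN => _ _; apply.
Qed.

(** The contraction h of cochains with a is a homotopy from 0 to the
    multiplication by f: d (h y) + h (d y) = f y. If d y = 0 modulo N, then
    h y is a cocycle modulo N' = N + f M, and a solution of
    h y = d w + f u modulo N, with d d = 0, gives f (y - d u) = 0 modulo N. Here
    f is then cancelled. This is the connecting map
    H^(k-1) (M / N') -> H^k (M / N), onto because f acts as zero on the
    right. *)
Lemma koszul_exact1_step : koszul_exact0 N' -> koszul_exact1 N.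
Proof.
move=> exN' y My Ny; have [_ ND NM] := idealN; have [_ _ MM] := idealM.
have Mhy : M (\sum_i a i * y i) by apply: ideal_pred_sum => // i; apply: MM.
have hyE j : x j * (\sum_i a i * y i) =
    \sum_i a i * (- (x i * y j - x j * y i)) + f * y j.
  rewrite f_in_x mulr_suml mulr_sumr -big_split /=.
  by apply: eq_bigr => i _; ring.
have Nhy j : N (\sum_i a i * (- (x i * y j - x j * y i))).
  by apply: ideal_pred_sum => // i; rewrite mulrN -mulNr; apply: NM.
have /N'E[h [u [Nh Mu yE]]] : N' (\sum_i a i * y i).
  by apply: exN' => // j; apply/N'E; do 2!eexists; split; last exact: hyE.
exists u => // j; apply: f_regular; first exact: ideal_predB (MM _ _ _).
have -> : f * (y j - x j * u) =
    x j * h - \sum_i a i * (- (x i * y j - x j * y i)).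
  have fyE := hyE j; rewrite yE in fyE.
  by rewrite mulrBr (canRL (addKr _) (esym fyE)); ring.
exact: ideal_predB (NM _ _ _) _.
Qed.

(** The same argument one degree higher. *)
Lemma koszul_exact2_step : koszul_exact1 N' -> koszul_exact2 N.
Proof.
move=> exN' z Mz Nz; have [_ ND NM] := idealN; have [_ _ MM] := idealM.
pose y j := \sum_i a i * z i j.
pose r j k := \sum_i a i * (x i * z j k - x j * z i k + x k * z i j).
have My j : M (y j) by apply: ideal_pred_sum => // i; apply: MM.
have Nr j k : N (r j k) by apply: ideal_pred_sum => // i; apply: NM.
have dyE j k : x j * y k - x k * y j = f * z j k - r j k.
  rewrite f_in_x /y /r mulr_suml !mulr_sumr -!sumrB.
  by apply: eq_bigr => i _; ring.
have [j k|w Mw yE] := exN' y My.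
  apply/N'E; exists (- r j k), (z j k); rewrite dyE addrC; split=> //.
  by rewrite -mulN1r; apply: NM.
have {yE} /choice[u] : forall j, exists u, M u /\ N (y j - x j * w - f * u).
  move=> j; have /N'E[h [u [Nh Mu ->]]] := yE j.
  by exists u; rewrite addrK.
move=> uP; exists u => [j|j k]; first by case: (uP j).
have [[Mj Nj] [Mk Nk]] := (uP j, uP k).
apply: f_regular.
  by apply: ideal_predB => //; apply: ideal_predB => //; apply: MM.
have -> : f * (z j k - (x j * u k - x k * u j)) =
    r j k + (x j * (y k - x k * w - f * u k) - x k * (y j - x j * w - f * u j)).
  have fzE : f * z j k = r j k + (x j * y k - x k * y j).
    by rewrite dyE addrC subrK.
  by rewrite mulrBr fzE; move: (r j k) (y j) (y k) => *; ring.
by apply: ND => //; apply: ideal_predB => //; apply: NM.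
Qed.

End KoszulVanishing.

(** * Transversals from determinants *)

Section MarkedTransversal.
Local Open Scope ring_scope.

(** A nonsingular matrix a and a singular matrix a' obtained from it by erasing
    entries have different determinants, so their expansions differ in some
    term; such a term is nonzero for a and passes through an erased entry. The
    columns of a being independent, a nonsingular square part of full width can
    be chosen first. *)
Lemma marked_transversal (K : fieldType) (T U : finType) (R : {set T})
    (S : {set U}) (a a' : T -> U -> K) :
    (forall v : U -> K, (forall t, t \in R -> \sum_(u in S) a t u * v u = 0) ->
       forall u, u \in S -> v u = 0) ->
    (exists2 v : U -> K, forall t, t \in R -> \sum_(u in S) a' t u * v u = 0
       & exists2 u, u \in S & v u != 0) ->
    (forall t u, a' t u = a t u \/ a' t u = 0) ->
  exists f : U -> T,
    [/\ forall u, u \in S -> f u \in R, {in S &, injective f},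
        forall u, u \in S -> a (f u) u != 0
      & exists2 u, u \in S & a' (f u) u != a (f u) u].
Proof.
move=> a_inj [v av0 [u0 Su0 vu0]] a'P.
pose mx (b : T -> U -> K) : 'M[K]_(#|R|, #|S|) :=
  \matrix_(i, j) b (enum_val i) (enum_val j).
have fullA : row_full (mx a).
  rewrite /row_full -mxrank_tr; apply: inj_row_free => w wA0.
  pose v' u := w 0 (enum_rank_in Su0 u).
  have v'E j : v' (enum_val j) = w 0 j by rewrite /v' enum_valK_in.
  apply/rowP => j; rewrite mxE -v'E; apply: a_inj (enum_valP j) => t Rt.
  have /rowP/(_ (enum_rank_in Rt t)) := wA0; rewrite !mxE; apply: etrans.
  rewrite big_enum_val; apply: eq_bigr => i _.
  by rewrite !mxE enum_rankK_in // v'E mulrC.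
(* r selects the rows of a nonsingular square part. *)
pose r := fullrankfun fullA.
pose D (b : T -> U -> K) := rowsub r (mx b).
have detD : \det (D a) != 0 by rewrite -unitfE -unitmxE fullrowsub_unit.
have detD' : \det (D a') = 0.
  pose w : 'cV[K]_#|S| := \col_i v (enum_val i).
  have Dw : D a' *m w = 0.
    apply/colP => i; rewrite !mxE; have := av0 (enum_val (r i)) (enum_valP _).
    by apply: etrans; rewrite [RHS]big_enum_val; apply: eq_bigr => j _;
       rewrite !mxE.
  apply: contraNeq vu0 => D'n0.
  have D'full : row_full (D a') by rewrite row_full_unit unitmxE unitfE.
  have /colP/(_ (enum_rank_in Su0 u0)) : w = 0.
    by apply: (row_full_inj D'full); rewrite Dw mulmx0.
  by rewrite !mxE enum_rankK_in // => ->; rewrite eqxx.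
have [s sP] : exists s : 'S_#|S|,
    \prod_i D a i (s i) != \prod_i D a' i (s i).
  apply/existsP; rewrite -negb_forall; apply: contra detD => /forallP eqD.
  rewrite -detD'; apply/eqP/eq_bigr => s _; congr (_ * _); exact/eqP/eqD.
have DP i j : D a' i j = D a i j \/ D a' i j = 0 by rewrite !mxE; apply: a'P.
have Ds0 i : D a i (s i) != 0.
  apply: contra sP => /eqP Di0; have D'i0 : D a' i (s i) = 0.
    by case: (DP i (s i)) => ->.
  by rewrite (bigD1 i) // [X in _ == X](bigD1 i) //= Di0 D'i0 !mul0r.
have [i iP] : exists i, D a i (s i) != D a' i (s i).
  apply/existsP; rewrite -negb_forall; apply: contra sP => /forallP eqD.
  by apply/eqP/eq_bigr => i _; exact/eqP/eqD.
pose k u := (s^-1)%g (enum_rank_in Su0 u).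
have skE u : u \in S -> enum_val (s (k u)) = u.
  by move=> Su; rewrite /k permKV enum_rankK_in.
exists (fun u => enum_val (r (k u))); split.
- by move=> u _; apply: enum_valP.
- move=> u u' Su Su' /enum_val_inj /fullrankfun_inj kk.
  by rewrite -(skE u Su) kk skE.
- by move=> u Su; have := Ds0 (k u); rewrite !mxE skE.
exists (enum_val (s i)); first exact: enum_valP.
by move: iP; rewrite /k enum_valK_in permK !mxE eq_sym.
Qed.

End MarkedTransversal.

(** * Square free monomial ideals *)

Section SquareFreeIdeals.
Local Open Scope ring_scope.

Variables (K : fieldType) (n : nat).
Implicit Types (f p : {mpoly K[n]}) (m : 'X_{1..n}) (A : {set 'I_n}).
Implicit Types (G H : {set {set 'I_n}}).

Lemma mcoeffMX_neq0 p m k : (p * 'X_[k])@_m != 0 -> (k <= m)%MM.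
Proof.
rewrite -mcoeff_msupp (perm_mem (msuppMX _ _)) => /mapP[m' _ ->].
exact: lem_addr.
Qed.

Lemma mesym1_le A A' : (mesym1 A <= mesym1 A')%MM = (A \subset A').
Proof.
apply/mnm_lepP/subsetP => [leA i Ai|sA i].
  by have := leA i; rewrite !mnmE Ai; case: (i \in A').
by rewrite !mnmE; case: (boolP (i \in A)) => // /sA ->.
Qed.

Lemma sqf_ideal_pred G : ideal_pred (sqf_ideal (K := K) G).
Proof.
split.
- by exists (fun=> 0); rewrite big1 // => A _; rewrite mul0r.
- move=> _ _ [c ->] [c' ->]; exists (fun A => c A + c' A).
  by rewrite -big_split; apply: eq_bigr => A _; rewrite mulrDl.
- move=> d _ [c ->]; exists (fun A => d * c A).
  by rewrite mulr_sumr; apply: eq_bigr => A _; rewrite mulrA.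
Qed.

(** The only way in which membership in a monomial ideal is used: every monomial
    that occurs in f lies in the ideal. *)
Lemma sqf_ideal_mcoeff G f m :
  sqf_ideal G f -> f@_m != 0 -> exists2 A, A \in G & (mesym1 A <= m)%MM.
Proof.
case=> c -> cm; apply: contrapT => noA; case/eqP: cm.
rewrite raddf_sum big1 //= => A GA; apply: contra_notP noA => /eqP cA.
by exists A => //; apply: mcoeffMX_neq0 cA.
Qed.

Lemma sqf_idealX G A :
  sqf_ideal (K := K) G 'X_[mesym1 A] <-> exists2 g, g \in G & g \subset A.
Proof.
split=> [GA|[g Gg sgA]].
  have [|g Gg] := sqf_ideal_mcoeff (m := mesym1 A) GA.
    by rewrite mcoeffX eqxx oner_eq0.
  by rewrite mesym1_le; exists g.
exists (fun h => if h == g then 'X_[mesym1 A - mesym1 g] else 0).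
rewrite (bigD1 g) //= eqxx big1 ?addr0 => [|h /andP[_ /negPf->]]; last first.
  by rewrite mul0r.
by rewrite -mpolyXD submK // mesym1_le.
Qed.

Lemma mpolyX_set2 (i j : 'I_n) : i != j ->
  'X_i * 'X_j = 'X_[mesym1 [set i; j]] :> {mpoly K[n]}.
Proof.
move=> neq_ij; rewrite -mpolyXD; congr 'X_[_]; apply/mnmP => k.
rewrite mnmDE !mnm1E mnmE !inE ![k == _]eq_sym.
by have [<-|_] := eqVneq i k => //=; rewrite eq_sym (negPf neq_ij).
Qed.

Lemma mpolyX_set3 (i j k : 'I_n) : i != j -> i != k -> j != k ->
  'X_i * 'X_j * 'X_k = 'X_[mesym1 [set i; j; k]] :> {mpoly K[n]}.
Proof.
move=> neq_ij neq_ik neq_jk; rewrite mpolyX_set2 // -mpolyXD; congr 'X_[_].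
apply/mnmP => l; rewrite mnmDE mnm1E !mnmE !inE (eq_sym k).
have [->|_] := eqVneq l k; last by rewrite orbF addn0.
by rewrite ![k == _]eq_sym (negPf neq_ik) (negPf neq_jk).
Qed.

Lemma graded_max_idealE f : graded_max_ideal f ->
  exists a : 'I_n -> {mpoly K[n]}, f = \sum_i a i * 'X_i.
Proof.
case=> c ->; exists (fun i => c [set i]).
rewrite big_imset /=; last by move=> i j _ _ /set1_inj.
by apply: eq_bigr => i _; rewrite mesym1_set1.
Qed.

Lemma sqf_monomialsP G H A :
  reflect ((exists2 g, g \in G & g \subset A) /\
           (forall g, g \in H -> ~~ (g \subset A)))
    (A \in sqf_monomials (sqf_ideal (K := K) G) (sqf_ideal H)).
Proof.
rewrite inE; apply: (iffP (asboolP _)) => [[/sqf_idealX GA HA]|[GA HA]].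
  split=> // g Hg; apply/negP => sgA; apply: HA.
  by apply/sqf_idealX; exists g.
split; first exact/sqf_idealX.
by case/sqf_idealX => g Hg; apply/negP/HA.
Qed.

End SquareFreeIdeals.

(** * Regular sequences and depth *)

Section RegularSequences.
Local Open Scope ring_scope.

Lemma seq_submod_nil (R : comNzRingType) (M N : R -> Prop) g :
  seq_submod M N [::] g <-> N g.
Proof.
split=> [[h [u [Nh _ ->]]]|Ng]; first by rewrite big_ord0 addr0.
by exists g, (fun=> 0); split=> //; [case | rewrite big_ord0 addr0].
Qed.

(** Relates the submodules of consecutive prefixes of a sequence as N and
    N' = N + f M. *)
Lemma seq_submod_rcons (R : comNzRingType) (M N : R -> Prop) s f g :
  seq_submod M N (rcons s f) g <->
  exists h u, [/\ seq_submod M N s h, M u & g = h + f * u].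
Proof.
have lt_s (i : 'I_(size s)) : (i < size (rcons s f))%N.
  by rewrite size_rcons ltnS ltnW.
have lt_f : (size s < size (rcons s f))%N by rewrite size_rcons.
have sumE (u : 'I_(size (rcons s f)) -> R) :
    \sum_(j < size (rcons s f)) (rcons s f)`_j * u j =
      \sum_(j < size s) s`_j * u (Ordinal (lt_s j)) + f * u (Ordinal lt_f).
  move: (lt_s) (lt_f) u; rewrite size_rcons => lt_s' lt_f' u.
  rewrite big_ord_recr /=; congr (_ + _).
    apply: eq_bigr => j _; rewrite nth_rcons ltn_ord; congr (_ * u _).
    exact: val_inj.
  by rewrite nth_rcons ltnn eqxx (_ : Ordinal lt_f' = ord_max) //; apply: val_inj.
split=> [[h [u [Nh Mu ->]]]|[_ [u [[h [v [Nh Mv ->]]] Mu ->]]]].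
  exists (h + \sum_(j < size s) s`_j * u (Ordinal (lt_s j))), (u (Ordinal lt_f)).
  by split=> //; [exists h, (fun j => u (Ordinal (lt_s j))) | rewrite sumE addrA].
exists h, (fun j => if insub (val j) is Some i then v i else u).
split=> // [j|]; first by case: insub.
rewrite sumE /= -addrA insubF ?ltnn //; congr (_ + (_ + _)).
by apply: eq_bigr => j _; rewrite valK.
Qed.

Lemma seq_submod_ideal (R : comNzRingType) (M N : R -> Prop) s :
  ideal_pred M -> ideal_pred N -> ideal_pred (seq_submod M N s).
Proof.
move=> [M0 MD MM] [N0 ND NM]; split.
- exists 0, (fun=> 0); split=> //.
  by rewrite add0r big1 // => j _; rewrite mulr0.
- move=> _ _ [h [u [Nh Mu ->]]] [h' [u' [Nh' Mu' ->]]].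
  exists (h + h'), (fun j => u j + u' j); split; auto.
  rewrite addrACA -big_split; congr (_ + _).
  by apply: eq_bigr => j _; rewrite mulrDr.
- move=> c _ [h [u [Nh Mu ->]]].
  exists (c * h), (fun j => c * u j); split; auto.
  rewrite mulrDr mulr_sumr; congr (_ + _).
  by apply: eq_bigr => j _; rewrite mulrCA.
Qed.

(** Each of the three regular elements raises by one the degree up to which the
    Koszul cohomology vanishes, starting from the last one. *)
Lemma regular_seq_koszul_exact2 (R : comNzRingType) (T : finType) (x : T -> R)
    (m M N : R -> Prop) (s : seq R) :
    ideal_pred M -> ideal_pred N ->
    (forall f, m f -> exists a : T -> R, f = \sum_i a i * x i) ->
    regular_seq m M N s -> (3 <= size s)%N ->
  koszul_exact2 x M N.
Proof.
move=> idM idN mx [ms reg _]; case: s ms reg => [|f1 [|f2 [|f3 s]]] // ms reg _.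
have [|a1 a1E] := mx f1; first by apply: ms; rewrite !inE eqxx ?orbT.
have [|a2 a2E] := mx f2; first by apply: ms; rewrite !inE eqxx ?orbT.
have [|a3 a3E] := mx f3; first by apply: ms; rewrite !inE eqxx ?orbT.
have idS s' := seq_submod_ideal s' idM idN.
have exact0 := koszul_exact0_regular (idS [:: f1; f2]) a3E (reg 2 isT).
have exact1 := koszul_exact1_step idM (idS [:: f1]) a2E (reg 1 isT)
  (seq_submod_rcons M N [:: f1] f2) exact0.
have reg0 g : M g -> N (f1 * g) -> N g.
  move=> Mg Ng; apply/(seq_submod_nil M N).
  by apply: (reg 0%N isT g Mg); apply/(seq_submod_nil M N).
apply: (koszul_exact2_step idM idN a1E reg0 _ exact1) => g.
rewrite (seq_submod_rcons M N [::]); split=> -[h [u [Nh Mu ->]]]; exists h, u;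
  by split=> //; apply/(seq_submod_nil M N).
Qed.

(** As M is not contained in N, the empty sequence is regular, so a bound on the
    lengths of the regular sequences gives a maximal length. *)
Lemma exists_depth_le (R : comNzRingType) (m M N : R -> Prop) (d : nat) :
    (exists g, M g /\ ~ N g) ->
    (forall s, regular_seq m M N s -> (size s <= d)%N) ->
  exists2 e, is_depth m M N e & (e <= d)%N.
Proof.
move=> [g [Mg Ng]] bound.
pose P e := `[< exists2 s, regular_seq m M N s & size s = e >].
have exP : exists e, P e.
  exists 0%N; apply/asboolP; exists [::] => //; split=> //.
  by exists g; split=> //; rewrite seq_submod_nil.
have leP e : P e -> (e <= d)%N by move/asboolP => [s /bound le_sd <-].
have [e /asboolP Pe maxe] := ex_maxnP exP leP.
exists e; last by apply: leP; apply/asboolP.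
by split=> // s sreg; apply: maxe; apply/asboolP; exists s.
Qed.

End RegularSequences.

(** * Interval partitions from matchings *)

Section PartitionFromMatching.

Lemma in_interval (n : nat) (P : {set {set 'I_n}}) p w :
  (w \in Defs.interval P p) = [&& w \in P, p.1 \subset w & w \subset p.2].
Proof. by rewrite in_set. Qed.

(** A partition into intervals amounts to a choice, for each element, of the
    interval that owns it. *)
Lemma interval_partition_owner (n : nat) (P : {set {set 'I_n}})
    (rho : {set 'I_n} -> {set 'I_n} * {set 'I_n}) :
    (forall w, w \in P ->
       [/\ (rho w).1 \in P, (rho w).2 \in P & w \in Defs.interval P (rho w)]) ->
    (forall w w', w \in P -> w' \in P -> w \in Defs.interval P (rho w') ->
       rho w = rho w') ->
  interval_partition P (rho @: P).
Proof.
move=> rhoP rho_eq; apply/and3P; split.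
- apply/forall_inP => _ /imsetP[w Pw ->]; have [-> ->] := rhoP w Pw.
  by rewrite inE => /and3P[_]; apply: subset_trans.
- apply/forall_inP => _ /imsetP[w Pw ->].
  apply/forall_inP => _ /imsetP[w' Pw' ->]; apply/implyP; apply: contraR.
  case/pred0Pn => y /andP[/= wy w'y].
  have Py : y \in P by move: wy; rewrite inE => /andP[].
  by rewrite -(rho_eq _ _ Py Pw wy) (rho_eq _ _ Py Pw' w'y).
- apply/eqP/setP => w; apply/idP/bigcupP => [Pw|[p _]]; last by rewrite inE => /andP[].
  by exists (rho w); [apply: imset_f | case: (rhoP w Pw)].
Qed.

(** Elements of [x, v] are owned by that interval; the other elements b of
    degree 2 are bottoms of [b, m b] = {b, m b}, which misses [x, v] because
    m b has the same degree as v and differs from it. All the remaining elements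
    have degree at least 3 and can stand alone. *)
Lemma sdepth_ge3_matching (K : fieldType) (n : nat) (I J : {mpoly K[n]} -> Prop)
    (x v : {set 'I_n}) (m : {set 'I_n} -> {set 'I_n}) :
    let P := sqf_monomials I J in
    let B := [set b in P | (#|b| == 2) && ~~ ((x \subset b) && (b \subset v))] in
    x \in P -> v \in P -> x \subset v -> #|v| = 3 ->
    (forall w, w \in P -> #|w| < 2 -> w = x) ->
    (forall b, b \in B -> [/\ m b \in P, #|m b| = 3, b \subset m b & m b != v]) ->
    {in B &, injective m} ->
  3 <= sdepth I J.
Proof.
move=> P B Px Pv sxv v3 P1 mP m_inj.
pose rho (w : {set 'I_n}) := if (x \subset w) && (w \subset v) then (x, v)
  else if #|w| == 2 then (w, m w)
  else if [pick b in B | m b == w] is Some b then (b, w) else (w, w).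
have Nv (w : {set _}) : #|w| = 3 -> w != v -> (x \subset w) && (w \subset v) = false.
  move=> w3; apply: contraNF => /andP[_ swv].
  by rewrite eqEcard swv w3 v3.
have rhoB (b w : {set 'I_n}) : b \in B -> w \in P -> b \subset w -> w \subset m b ->
    rho w = (b, m b).
  move=> Bb Pw sbw swm; have [Pm m3 sbm mv] := mP b Bb.
  have := Bb; rewrite in_set => /and3P[Pb /eqP b2 bv].
  have : (w == b) || (w == m b).
    rewrite [w == b]eq_sym !eqEcard sbw swm m3 b2 /=.
    by case: leqP => //= w2; apply: leq_trans w2.
  case/orP => /eqP->; rewrite /rho; first by rewrite (negPf bv) b2 eqxx.
  rewrite Nv // m3 /=; case: pickP => [b' /andP[Bb' /eqP mbb']|/(_ b)].
    by rewrite (m_inj _ _ Bb' Bb mbb').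
  by rewrite Bb eqxx.
have rho_spec (w : {set 'I_n}) : w \in P ->
    [\/ [/\ rho w = (x, v), x \subset w & w \subset v],
        exists2 b, b \in B & [/\ rho w = (b, m b), b \subset w & w \subset m b]
      | rho w = (w, w) /\ 2 < #|w|].
  move=> Pw; rewrite /rho; case: ifP => [/andP[xw wv]|wv]; first by constructor 1.
  case: eqP => [w2|w2].
    have Bw : w \in B by rewrite in_set Pw w2 wv.
    by constructor 2; exists w => //; split=> //; case: (mP w Bw).
  case: pickP => [b /andP[Bb /eqP <-]|_].
    by constructor 2; exists b => //; split=> //; case: (mP b Bb).
  constructor 3; split=> //; rewrite ltnNge; apply/negP => w_le2.
  case/negP: (negbT wv); rewrite (P1 w Pw) ?subxx //.
  by rewrite ltn_neqAle w_le2 andbT; apply/eqP.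
have rho_in w : w \in P ->
    [/\ (rho w).1 \in P, (rho w).2 \in P & w \in Defs.interval P (rho w)].
  move=> Pw; case: (rho_spec w Pw) => [[-> xw wv]|[b Bb [-> bw wm]]|[-> _]].
  - by rewrite in_interval /= Pw xw.
  - have [Pm _ _ _] := mP b Bb; have := Bb; rewrite in_set => /andP[Pb _].
    by rewrite in_interval /= Pw Pb bw.
  - by rewrite in_interval /= Pw subxx.
have rho_eq w w' : w \in P -> w' \in P -> w \in Defs.interval P (rho w') ->
    rho w = rho w'.
  move=> Pw Pw'; case: (rho_spec w' Pw') => [[-> _ _]|[b Bb [-> _ _]]|[rw' _]].
  - by rewrite in_interval => /and3P[_ /= xw wv]; rewrite /rho xw wv.
  - by rewrite in_interval => /and3P[_ /= bw wm]; apply: rhoB.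
  - rewrite rw' in_interval => /and3P[_ /= w'w ww'].
    have eq_w : w = w' by apply/eqP; rewrite eqEsubset ww'.
    by rewrite eq_w.
have partP := interval_partition_owner rho_in rho_eq.
apply: leq_trans (leq_bigmax_cond _ partP).
have n3 : 3 <= n by rewrite -v3 -[n in _ <= n]card_ord max_card.
rewrite /partition_sdepth; elim/big_ind: _ => // [k l k3 l3|p].
  by rewrite leq_min k3.
case/imsetP => w Pw ->; case: (rho_spec w Pw) => [[-> _ _]|[b Bb [-> _ _]]|[-> //]].
  by rewrite v3.
by have [_ /= -> _ _] := mP b Bb.
Qed.

End PartitionFromMatching.

(** * The simplicial coboundary from degree 2 to degree 3 *)

Section Coboundary.
Local Open Scope ring_scope.

Variables (K : fieldType) (n : nat).
Implicit Types (z : {set 'I_n.+1} -> K) (b c : {set 'I_n.+1}).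

(** The sign that turns a function on unordered pairs into an alternating
    function on ordered pairs. *)
Definition orient (i j : 'I_n.+1) : K := (i < j)%:R - (j < i)%:R.

Definition altern z (i j : 'I_n.+1) : K := orient i j * z [set i; j].

Definition altern_cob z (i j k : 'I_n.+1) : K :=
  altern z j k - altern z i k + altern z i j.

(** Out of range entries of enum c default to ord0, so cob is meaningful for
    #|c| = 3 only. *)
Definition cob z c : K :=
  altern_cob z (enum c)`_0 (enum c)`_1 (enum c)`_2.

Lemma orient_neq0 i j : i != j -> orient i j != 0.
Proof.
rewrite /orient -(inj_eq val_inj) /=; case: ltngtP => //= _ _.
  by rewrite subr0 oner_eq0.
by rewrite sub0r oppr_eq0 oner_eq0.
Qed.

Lemma alternC z i j : altern z i j = - altern z j i.
Proof. by rewrite /altern setUC /orient -mulNr opprB. Qed.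

Lemma alternii z i : altern z i i = 0.
Proof. by rewrite /altern /orient subrr mul0r. Qed.

Lemma set3_enum c : #|c| = 3%N ->
  exists i j k, [/\ c = [set i; j; k], [&& i != j, i != k & j != k]
    & forall z, cob z c = altern_cob z i j k].
Proof.
rewrite /cob cardE => c3; have := enum_uniq c; have := mem_enum c.
case: (enum c) c3 => [|i [|j [|k []]]] //= _ cE.
rewrite !inE negb_or andbT => /andP[/andP[nij nik] njk].
exists i, j, k; split=> //; last by rewrite nij nik.
by apply/setP => l; rewrite -cE !inE orbA.
Qed.

Lemma cards3 (i j k : 'I_n.+1) : i != j -> i != k -> j != k ->
  #|[set i; j; k]| = 3%N.
Proof.
move=> nij nik njk.
by rewrite setUC cardsU1 cards2 !inE negb_or ![k == _]eq_sym nij nik njk.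
Qed.

(** [altern_cob z] is alternating, so its vanishing does not depend on the order
    in which c is enumerated. *)
Lemma altern_cob_eq0 z i j k : i != j -> i != k -> j != k ->
  cob z [set i; j; k] = 0 -> altern_cob z i j k = 0.
Proof.
move=> nij nik njk.
have [p [q [r [cE /and3P[npq npr nqr] ->]]]] := set3_enum (cards3 nij nik njk).
have : [&& i \in [set p; q; r], j \in [set p; q; r] & k \in [set p; q; r]].
  by rewrite -cE !inE !eqxx !orbT.
rewrite !inE -!orbA => /and3P[].
(* Of the 27 placements of i, j, k the 6 permutations survive. *)
move=> /or3P[] /eqP ei /or3P[] /eqP ej /or3P[] /eqP ek;
  move: nij nik njk; rewrite {}ei {}ej {}ek ?eqxx // => _ _ _; rewrite /altern_cob;
  rewrite ?(alternC z q p) ?(alternC z r p) ?(alternC z r q);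
  move: (altern z p q) (altern z p r) (altern z q r) => a b c pqr0;
  (have -> : a = b - c by apply/eqP; rewrite -subr_eq0 -pqr0; apply/eqP; ring); ring.
Qed.

Definition cob_coef (c b : {set 'I_n.+1}) : K :=
  cob (fun b' => (b' == b)%:R) c.

Lemma cob_sum (S : {set {set 'I_n.+1}}) z c :
  \sum_(b in S) cob_coef c b * z b = cob (fun b => (b \in S)%:R * z b) c.
Proof.
rewrite /cob_coef /cob.
move: (enum c)`_0 (enum c)`_1 (enum c)`_2 => i j k; rewrite /altern_cob.
have alternE p q : altern (fun b => (b \in S)%:R * z b) p q =
    \sum_(b in S) altern (fun b' => (b' == b)%:R) p q * z b.
  rewrite /altern; have [Spq|nSpq] := boolP ([set p; q] \in S).
    rewrite (bigD1 [set p; q]) //= eqxx big1 ?addr0 ?mul1r ?mulr1 //.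
    by move=> b /andP[_]; rewrite eq_sym => /negPf->; rewrite mulr0 mul0r.
  rewrite mul0r mulr0 big1 // => b Sb.
  have /negPf-> : [set p; q] != b by apply: contraNneq nSpq => ->.
  by rewrite mulr0 mul0r.
rewrite !alternE -sumrB -big_split /=.
by apply: eq_bigr => b _; rewrite mulrDl mulrBl.
Qed.

Lemma cob_coef_neq0 c b : #|c| = 3%N -> cob_coef c b != 0 -> b \subset c.
Proof.
move=> c3; rewrite /cob_coef; have [i [j [k [cE _ ->]]]] := set3_enum c3.
rewrite /altern_cob /altern => nz; apply: contraNT nz => sbc.
have neq p q : p \in c -> q \in c -> ([set p; q] == b) = false.
  move=> cp cq; apply: contraNF sbc => /eqP <-.
  by apply/subsetP => l /set2P[] ->.
by rewrite !neq ?cE ?inE ?eqxx ?orbT // !mulr0 subrr addr0.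
Qed.

Lemma eq_cob z z' c : #|c| = 3%N ->
  (forall b, b \subset c -> #|b| = 2%N -> z b = z' b) -> cob z c = cob z' c.
Proof.
move=> c3 eqz; have [i [j [k [cE _ czE]]]] := set3_enum c3.
have eqa p q : p \in c -> q \in c -> altern z p q = altern z' p q.
  move=> cp cq; have [->|npq] := eqVneq p q; first by rewrite !alternii.
  rewrite /altern eqz ?cards2 ?npq //.
  by apply/subsetP => l /set2P[] ->.
by rewrite !czE /altern_cob !eqa ?cE ?inE ?eqxx ?orbT.
Qed.

(** The coboundary of the coboundary of x_1 is zero: on the pairs inside c the
    function at hand is, up to orientation, the difference of the values of the
    indicator of ord0. *)
Lemma cob_star c : #|c| = 3%N ->
  cob (fun b => ((ord0 \in b) && (b \subset c))%:R) c = 0 :> K.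
Proof.
move=> c3; have [i [j [k [cE /and3P[nij nik njk] ->]]]] := set3_enum c3.
have [c0|nc0] := boolP (ord0 \in c); last first.
  rewrite /altern_cob /altern.
  have F (b : {set 'I_n.+1}) : ((ord0 \in b) && (b \subset c)) = false.
    by apply/negP => /andP[b0 /subsetP/(_ _ b0)]; apply/negP.
  by rewrite !F !mulr0 subrr addr0.
have starE p q : p != q -> p \in c -> q \in c ->
    altern (fun b => ((ord0 \in b) && (b \subset c))%:R) p q =
      (p == ord0)%:R - (q == ord0)%:R.
  move=> npq cp cq; rewrite /altern /orient !inE ![ord0 == _]eq_sym.
  have -> : [set p; q] \subset c by apply/subsetP => l /set2P[] ->.
  rewrite andbT; have [p0|p0] := eqVneq p ord0; have [q0|q0] := eqVneq q ord0.
  - by rewrite p0 q0 eqxx in npq.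
  - by rewrite p0 /= lt0n (inj_eq val_inj q ord0) q0 mulr1.
  - by rewrite q0 /= lt0n (inj_eq val_inj p ord0) p0 mulr1.
  - by rewrite mulr0 subrr.
by rewrite /altern_cob !starE ?cE ?inE ?eqxx ?orbT //; ring.
Qed.

End Coboundary.

(** * Depth at least 3 implies Stanley depth at least 3 *)

Section DegreeZeroStrand.
Local Open Scope ring_scope.

Variables (K : fieldType) (n : nat) (G E : {set {set 'I_n.+1}}).
Notation I := (sqf_ideal (K := K) ([set ord0] |: E)).
Notation J := (sqf_ideal (K := K) G).
Notation P := (sqf_monomials I J).

Hypothesis G_deg : forall g, g \in G -> (2 <= #|g|)%N.
Hypothesis E_deg : forall a, a \in E -> #|a| = 2%N /\ ord0 \notin a.
Hypothesis exact2 : koszul_exact2 (fun i => 'X_i : {mpoly K[n.+1]}) I J.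

Lemma J_linear_mcoeff f i : J f -> f@_U_(i) = 0.
Proof.
move=> Jf; apply/eqP; apply: contraT => /(sqf_ideal_mcoeff Jf)[g Gg].
rewrite -mesym1_set1 mesym1_le => /subset_leq_card; rewrite cards1.
by move/(leq_trans (G_deg Gg)).
Qed.

Lemma I_linear_mcoeff f i : I f -> i != ord0 -> f@_U_(i) = 0.
Proof.
move=> If ni0; apply/eqP; apply: contraT => /(sqf_ideal_mcoeff If)[A].
rewrite -mesym1_set1 mesym1_le => /setU1P[->|/E_deg[A2 _]].
  by rewrite sub1set inE eq_sym (negPf ni0).
by move/subset_leq_card; rewrite A2 cards1.
Qed.

Lemma I_constant_mcoeff f : I f -> f@_0 = 0.
Proof.
move=> If; apply/eqP; apply: contraT => /(sqf_ideal_mcoeff If)[A].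
rewrite -mesym1_set0 mesym1_le subset0 => /setU1P[->|/E_deg[A2 _]] /eqP A0.
  by have := cards1 (ord0 : 'I_n.+1); rewrite A0 cards0.
by rewrite A0 cards0 in A2.
Qed.

Lemma J_mcoeff_notin f (A : {set 'I_n.+1}) : J f -> A \in P -> f@_(mesym1 A) = 0.
Proof.
move=> Jf /sqf_monomialsP[_ GA]; apply/eqP; apply: contraT.
by move=> /(sqf_ideal_mcoeff Jf)[g /GA/negPf]; rewrite mesym1_le => ->.
Qed.

Lemma P_or_J (A : {set 'I_n.+1}) : ord0 \in A -> A \in P \/ J 'X_[mesym1 A].
Proof.
move=> A0; have [JA|nJA] := pselect (J 'X_[mesym1 A]); first by right.
left; rewrite inE; apply/asboolP; split=> //.
by apply/sqf_idealX; exists [set ord0]; rewrite ?setU11 // sub1set.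
Qed.

(** If every x_1 x_j with j different from ord0 and i0 were in J, then x_1 times
    the basis element e_(ord0, i0) would be a Koszul cocycle. It is of
    multidegree 1/x_i0, where the only candidate for a cochain of degree 1 is a
    constant multiple of e_i0, and I contains no nonzero constant; so it would
    not be a coboundary. *)
Lemma edge_avoiding (i0 : 'I_n.+1) : i0 != ord0 ->
  exists j, [/\ j != ord0, j != i0 & [set ord0; j] \in P].
Proof.
move=> ni0; apply: contrapT => noj.
have Jx j : j != ord0 -> j != i0 -> J ('X_j * 'X_ord0).
  move=> nj0 nji; rewrite mulrC mpolyX_set2 1?eq_sym //.
  have [|Pj|//] := P_or_J (A := [set ord0; j]); first by rewrite !inE eqxx.
  by case: noj; exists j.
(* The alternating indicator of the pair (ord0, i0). *)
pose c (i j : 'I_n.+1) : {mpoly K[n.+1]} :=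
  (i == ord0)%:R * (j == i0)%:R - (j == ord0)%:R * (i == i0)%:R.
have [_ JD JM] := sqf_ideal_pred K G.
have [_ _ IM] := sqf_ideal_pred K ([set ord0] |: E).
have I0 : I 'X_ord0.
  by rewrite -mesym1_set1; apply/sqf_idealX; exists [set ord0]; rewrite ?setU11.
have [||w Iw Jw] := exact2 (z := fun i j => c i j * 'X_ord0).
- by move=> i j; apply: IM.
- move=> i j k.
  have cyc : J (('X_i * c j k - 'X_j * c i k + 'X_k * c i j) * 'X_ord0).
    have c0 l l' : l != ord0 -> l != i0 -> c l l' = 0 /\ c l' l = 0.
      by move=> /negPf l0 /negPf li; rewrite /c l0 li !mul0r !mulr0 subr0.
    have [/andP[ni nii]|ii] := boolP ((i != ord0) && (i != i0)).
      have [-> _] := c0 i k ni nii; have [-> _] := c0 i j ni nii.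
      by rewrite !mulr0 subr0 addr0 mulrAC; rewrite mulrC; apply: JM; apply: Jx.
    have [/andP[nj nji]|jj] := boolP ((j != ord0) && (j != i0)).
      have [-> _] := c0 j k nj nji; have [_ ->] := c0 j i nj nji.
      rewrite !mulr0 sub0r addr0 -mulrN mulrAC mulrC; apply: JM; exact: Jx.
    have [/andP[nk nki]|kk] := boolP ((k != ord0) && (k != i0)).
      have [_ ->] := c0 k j nk nki; have [_ ->] := c0 k i nk nki.
      rewrite !mulr0 subr0 add0r mulrAC mulrC; apply: JM; exact: Jx.
    rewrite (_ : _ * 'X_ord0 = 0); first by case: (sqf_ideal_pred K G).
    move: ii jj kk; rewrite !negb_and !negbK /c.
    move=> /orP[] /eqP-> /orP[] /eqP-> /orP[] /eqP->;
      rewrite !eqxx ?(negPf ni0) ?(eq_sym ord0) ?(negPf ni0); ring.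
  move: cyc; rewrite [X in J X -> _](_ : _ =
    'X_i * (c j k * 'X_ord0) - 'X_j * (c i k * 'X_ord0) +
    'X_k * (c i j * 'X_ord0)) //; ring.
have := J_linear_mcoeff ord0 (Jw ord0 i0).
rewrite /c !eqxx (eq_sym ord0) (negPf ni0) mulr0 subr0 !mul1r !mcoeffB mcoeffXU eqxx.
have -> : ('X_ord0 * w i0)@_U_(ord0) = 0.
  have := mcoeffMX (w i0) U_(ord0)%MM 0%MM; rewrite addm0 mulrC => ->.
  exact: I_constant_mcoeff (Iw i0).
have -> : ('X_i0 * w ord0)@_U_(ord0) = 0.
  apply/eqP; apply: contraT; rewrite mulrC => /mcoeffMX_neq0.
  by rewrite lep1mP mnm1E (eq_sym ord0) (negPf ni0).
by rewrite !subr0 => /eqP; rewrite oner_eq0.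
Qed.

(** A function z in the kernel of K^B -> K^C gives the Koszul cocycle
    z_ij x_i x_j, which is the coboundary of some w; the coefficient of x_i x_j
    reads z_ij = w_j - w_i, with w_i the coefficient of x_i in the component of
    w at i. As x_1 is the only variable in I, only the coefficient at ord0 can
    be nonzero, and z vanishing at x_1 x_i0 kills it too. *)
Lemma cob_inj (i0 : 'I_n.+1) (z : {set 'I_n.+1} -> K) :
    [set ord0; i0] \in P -> i0 != ord0 ->
    (forall b, z b != 0 -> [/\ b \in P, #|b| = 2%N & b != [set ord0; i0]]) ->
    (forall c, c \in P -> #|c| = 3%N -> cob z c = 0) ->
  forall b, z b = 0.
Proof.
move=> Pi0 ni0 z_supp cob0.
have [J0 _ JM] := sqf_ideal_pred K G.
have [I0 _ IM] := sqf_ideal_pred K ([set ord0] |: E).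
have z_out b : b \notin P -> z b = 0.
  by apply: contraNeq => /z_supp[].
have [||w Iw Jw] := exact2 (z := fun i j => altern z i j *: ('X_i * 'X_j)).
- move=> i j; rewrite -mul_mpolyC; have [->|nij] := eqVneq i j.
    by rewrite alternii mul_mpolyC scale0r.
  rewrite mpolyX_set2 //; have [Pij|nPij] := boolP ([set i; j] \in P).
    by apply: IM; move: Pij; rewrite inE => /asboolP[].
  by rewrite /altern z_out // mulr0 mul_mpolyC scale0r.
- move=> i j k.
  have -> : 'X_i * (altern z j k *: ('X_j * 'X_k)) -
      'X_j * (altern z i k *: ('X_i * 'X_k)) +
      'X_k * (altern z i j *: ('X_i * 'X_j)) =
      altern_cob z i j k *: ('X_i * 'X_j * 'X_k) :> {mpoly K[n.+1]}.
    by rewrite /altern_cob -!mul_mpolyC rmorphD rmorphB /=; ring.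
  rewrite -mul_mpolyC.
  have [ij|nij] := eqVneq i j.
    by rewrite ij /altern_cob alternii subrr add0r mul_mpolyC scale0r.
  have [ik|nik] := eqVneq i k.
    by rewrite ik /altern_cob alternii subr0 (alternC z k) addrN mul_mpolyC scale0r.
  have [jk|njk] := eqVneq j k.
    by rewrite jk /altern_cob alternii add0r addNr mul_mpolyC scale0r.
  rewrite mpolyX_set3 //; have [Pijk|nPijk] := boolP ([set i; j; k] \in P).
    rewrite altern_cob_eq0 ?mul_mpolyC ?scale0r //.
    by apply: cob0 => //; apply: cards3.
  have [JX|nJX] := pselect (J 'X_[mesym1 [set i; j; k]]); first exact: JM.
  (* A monomial of degree 3 outside I has no divisor in I at all. *)
  have sub_out (A : {set 'I_n.+1}) : A \subset [set i; j; k] -> z A = 0.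
    move=> sA; apply: z_out; apply: contra nPijk => /sqf_monomialsP[[g Eg sgA] _].
    rewrite inE; apply/asboolP; split=> //; apply/sqf_idealX; exists g => //.
    exact: subset_trans sgA sA.
  have s2 p q : p \in [set i; j; k] -> q \in [set i; j; k] -> z [set p; q] = 0.
    by move=> Ap Aq; apply: sub_out; apply/subsetP => l /set2P[] ->.
  rewrite /altern_cob /altern !s2 ?inE ?eqxx ?orbT //.
  by rewrite !mulr0 subrr addr0 mul_mpolyC scale0r.
have coefE i j : i != j -> [set i; j] \in P ->
    altern z i j = (w j)@_U_(j) - (w i)@_U_(i).
  move=> nij Pij; have := J_mcoeff_notin (Jw i j) Pij.
  have -> : mesym1 [set i; j] = (U_(i) + U_(j))%MM.
    apply/mnmP => k; rewrite mnmDE !mnm1E mnmE !inE ![k == _]eq_sym.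
    by have [<-|_] := eqVneq i k => //=; rewrite eq_sym (negPf nij).
  rewrite !mcoeffB mcoeffZ -mpolyXD mcoeffX eqxx mulr1.
  rewrite ['X_i * _]mulrC ['X_j * _]mulrC.
  rewrite mcoeffMX addmC mcoeffMX => /eqP; rewrite subr_eq0 => /eqP ->.
  by [].
have w0 : (w ord0)@_U_(ord0) = 0.
  have := coefE _ _ _ Pi0; rewrite eq_sym ni0 (I_linear_mcoeff (Iw i0)) //.
  have -> : altern z ord0 i0 = 0.
    rewrite /altern; have [->|/z_supp[_ _]] := eqVneq (z [set ord0; i0]) 0.
      by rewrite mulr0.
    by rewrite eqxx.
  by move=> /(_ isT)/eqP; rewrite sub0r eq_sym oppr_eq0 => /eqP.
have wE i : (w i)@_U_(i) = 0.
  by have [->|] := eqVneq i ord0; [exact: w0 | exact: I_linear_mcoeff].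
move=> b; apply/eqP; apply: contraT => zb; have [Pb b2 _] := z_supp b zb.
have /cards2P[i [j [nij bE]]] : #|b| == 2%N by rewrite b2.
rewrite bE in zb Pb; have /eqP := coefE _ _ nij Pb.
by rewrite !wE subrr mulf_eq0 (negPf (orient_neq0 K nij)) (negPf zb).
Qed.

(** Erasing the entries of the columns x_1 x_j in the rows divisible by x_i0
    makes the matrix singular: B0 contains all the pairs through ord0 inside a
    row c of P that avoids i0, so that the columns x_1 x_j sum to zero in this
    row by [cob_star]. *)
Lemma star_matching (i0 : 'I_n.+1) : i0 != ord0 -> [set ord0; i0] \in P ->
  exists f : {set 'I_n.+1} -> {set 'I_n.+1}, let B0 :=
      [set b in P | (#|b| == 2%N) && (b != [set ord0; i0])] in
    [/\ forall b, b \in B0 -> [/\ f b \in P, #|f b| = 3%N & b \subset f b],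
        {in B0 &, injective f}
      & exists2 b, b \in B0 & (ord0 \in b) && (i0 \in f b)].
Proof.
move=> ni0 Pi0; pose B0 := [set b in P | (#|b| == 2%N) && (b != [set ord0; i0])].
pose C := [set c in P | #|c| == 3%N].
pose a' (c b : {set 'I_n.+1}) :=
  if (ord0 \in b) && (i0 \in c) then 0 else cob_coef K c b.
have CP (c : {set 'I_n.+1}) : c \in C -> c \in P /\ #|c| = 3%N.
  by rewrite in_set => /andP[Pc /eqP].
have [||c b|f [fC f_inj f_nz [b1 Bb1 f1]]] :=
    @marked_transversal K _ _ C B0 (@cob_coef K n) a'.
- move=> z cob0 b Bb; have zE : (b \in B0)%:R * z b = 0; last first.
    by rewrite Bb mul1r in zE.
  pose z' (b : {set 'I_n.+1}) := (b \in B0)%:R * z b.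
  apply: (cob_inj (z := z') Pi0 ni0) => [b'|c Pc c3].
    rewrite /z'; case: (boolP (b' \in B0)) => [|_]; last by rewrite mul0r eqxx.
    by rewrite in_set => /and3P[Pb' /eqP b'2 b'i0].
  by rewrite -cob_sum; apply: cob0; rewrite in_set Pc c3.
- have [j [nj0 nji Pj]] := edge_avoiding ni0.
  exists (fun b : {set 'I_n.+1} => (ord0 \in b)%:R); last first.
    exists [set ord0; j]; last by rewrite !inE eqxx oner_eq0.
    rewrite in_set Pj cards2 (eq_sym ord0) nj0 /=.
    apply: contra nji => /eqP eqj; have : j \in [set ord0; i0].
      by rewrite -eqj !inE eqxx orbT.
    by rewrite !inE (negPf nj0).
  move=> c /CP[Pc c3]; have [ci0|nci0] := boolP (i0 \in c).
    rewrite big1 // => b _; rewrite /a' ci0 andbT.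
    by case: (ord0 \in b); rewrite ?mul0r ?mulr0.
  rewrite -[RHS](cob_star K c3).
  transitivity (\sum_(b in B0) cob_coef K c b * (ord0 \in b)%:R).
    by apply: eq_bigr => b _; rewrite /a' (negPf nci0) andbF.
  rewrite cob_sum; apply: eq_cob => // b sbc b2; rewrite sbc andbT.
  have [b0|_] := boolP (ord0 \in b); last by rewrite mulr0.
  suff -> : b \in B0 by rewrite mul1r.
  rewrite in_set b2 eqxx /=; apply/andP; split; last first.
    apply: contraNneq nci0 => bE; apply: (subsetP sbc).
    by rewrite bE !inE eqxx orbT.
  have [//|/sqf_idealX[g Gg sgb]] := P_or_J b0.
  have /sqf_monomialsP[_ /(_ g Gg)] := Pc.
  by rewrite (subset_trans sgb sbc).
- by rewrite /a'; case: ifP; [right | left].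
exists f; split=> //.
  move=> b Bb; have [Pf f3] := CP _ (fC b Bb).
  by split=> //; apply: cob_coef_neq0 (f_nz b Bb).
exists b1 => //; move: f1; rewrite /a'; case: ifP => // _.
by rewrite eqxx.
Qed.

Lemma sdepth_ge3 : E != set0 -> (3 <= sdepth I J)%N.
Proof.
case/set0Pn => e Ee; have [e2 e0] := E_deg Ee.
have [i ei] : exists i, i \in e by apply/set0Pn; rewrite -card_gt0 e2.
have ni : i != ord0 by apply: contraNneq e0 => <-.
have [i0 [ni0 _ Pi0]] := edge_avoiding ni.
have [f [fP f_inj [b1 Bb1 /andP[b10 fb1]]]] := star_matching ni0 Pi0.
have [Pv v3 sb1v] := fP b1 Bb1.
have v0 : ord0 \in f b1 by apply: (subsetP sb1v).
pose x : {set 'I_n.+1} := [set ord0].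
have B0b (b : {set 'I_n.+1}) :
    b \in [set b in P | (#|b| == 2%N) && ~~ ((x \subset b) && (b \subset f b1))] ->
    (b \in [set b in P | (#|b| == 2%N) && (b != [set ord0; i0])]) /\ b != b1.
  rewrite in_set sub1set => /and3P[Pb b2 nb]; rewrite in_set Pb b2; split.
    apply: contraNneq nb => ->; rewrite !inE eqxx /=.
    by apply/subsetP => l /set2P[] ->.
  by apply: contraNneq nb => ->; rewrite b10.
apply: (@sdepth_ge3_matching K n.+1 I J x (f b1) f).
- apply/sqf_monomialsP; split; first by exists x; rewrite ?setU11.
  by move=> g Gg; apply: contraL (G_deg Gg) => /subset_leq_card; rewrite cards1 -ltnNge.
- exact: Pv.
- by rewrite sub1set.
- exact: v3.
- move=> w /sqf_monomialsP[[g /setU1P[->|/E_deg[g2 _]] sgw] _] w1.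
    by apply/esym/eqP; rewrite eqEcard sgw cards1.
  by have := subset_leq_card sgw; rewrite g2 leqNgt w1.
- move=> b /B0b[Bb nb1]; have [Pf f3 sbf] := fP b Bb; split=> //.
  by apply: contra nb1 => /eqP/f_inj ->.
- by move=> b b' /B0b[Bb _] /B0b[Bb' _]; apply: f_inj.
Qed.

End DegreeZeroStrand.

Unset Implicit Arguments.

Theorem theorem1p10 (K : fieldType) (n : nat)
    (G E : {set {set 'I_n.+1}}) :
  let x1 : {set 'I_n.+1} := [set ord0] in
  let I : {mpoly K[n.+1]} -> Prop := sqf_ideal (x1 |: E) in
  let J : {mpoly K[n.+1]} -> Prop := sqf_ideal G in
  let B := [set b in sqf_monomials I J | #|b| == 2] in
  let C := [set c in sqf_monomials I J | #|c| == 3] in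
  let E' := [set a in E | (x1 :|: a) \in C] in
  let E'' := E :\: E' in
  let D := [set c in C | ~~ `[< sqf_ideal (K := K) (x1 |: E') 'X_[mesym1 c] >]] in
  (forall g, g \in G -> 2 <= #|g|) ->
  E != set0 ->
  (forall a, a \in E -> #|a| = 2 /\ ord0 \notin a) ->
  (forall f, J f -> I f) ->
  (exists f, I f /\ ~ J f) ->
  sdepth I J = 2 ->
  #|E''| <= #|D| \/ (#|E''| > #|D| /\ #|B| <> #|C| + 1) ->
  exists2 d, is_depth (graded_max_ideal (K := K) (n := n.+1)) I J d & d <= 2.
Proof.
move=> x1 I J B C E' E'' D G_deg E_n0 E_deg _ IJ sd2 _.
apply: exists_depth_le IJ _ => s s_reg; rewrite leqNgt; apply/negP => s3.
have exact2 : koszul_exact2 (fun i => 'X_i : {mpoly K[n.+1]})%R I J.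
  apply: regular_seq_koszul_exact2 s_reg s3; try exact: sqf_ideal_pred.
  exact: graded_max_idealE.
by have := sdepth_ge3 G_deg E_deg exact2 E_n0; rewrite -/I -/J sd2.
Qed.
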